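(* Let $n\ge 1$, let $A\in\mathbb{R}^{n\times n}$ be nonsingular, let $b\in\mathbb{R}^n$ and $\gamma>0$. Then $x^*\in\mathbb{R}^n$ is a solution of $Ax-|x|-b=0$ if and only if $x^*$ is an equilibrium point of the dynamical system $$\frac{dx}{dt}=\gamma A^\top\left(b+|x|-Ax\right).$$
   Context: The second-order cone is $\mathcal{K}^n=\{(x_1,x_2)\in\mathbb{R}\times\mathbb{R}^{n-1}:\|x_2\|\le x_1\}$, with $\|\cdot\|$ the Euclidean norm; for $n=1$, $\mathcal{K}^1=\mathbb{R}_+$. The vector $|x|$ is not the componentwise absolute value. It is $|x|=\sqrt{x\circ x}$ with respect to the Jordan product $x\circ y=(\langle x,y\rangle,\,y_1x_2+x_1y_2)$, where the square root is the one in $\mathcal{K}^n$ defined through the spectral decomposition. Explicitly, for $x=(x_1,x_2)\in\mathbb{R}\times\mathbb{R}^{n-1}$: $$|x|=\tfrac12\Big(\big|x_1-\|x_2\|\big|+\big|x_1+\|x_2\|\big|,\ \big(\big|x_1+\|x_2\|\big|-\big|x_1-\|x_2\|\big|\big)\tfrac{x_2}{\|x_2\|}\Big)\ \text{ if } x_2\ne 0,$$ and $|x|=(|x_1|,0)$ if $x_2=0$ (for $n=1$ this is the usual absolute value). An equilibrium point of an autonomous system $\frac{dx}{dt}=g(x)$, $g:\mathbb{R}^n\to\mathbb{R}^n$, is a point $x^*\in\mathbb{R}^n$ with $g(x^* )=0$. *)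

(* Defs.v *)
From HB Require Import structures.
From mathcomp Require Import all_boot all_order all_algebra.
From mathcomp Require Import reals.
From mathcomp Require Import ring lra.

Set Implicit Arguments.
Unset Strict Implicit.
Unset Printing Implicit Defensive.

Import Order.TTheory GRing.Theory Num.Theory.
Local Open Scope ring_scope.

(* R^n with n >= 1 is 'cV[R]_m.+1, where m = n - 1. Since m.+1 is convertible
   to 1 + m, a vector splits as (x_1, x_2) in R x R^m through the block
   operations of matrix.v. *)

Section SecondOrderCone.
Context {R : realType}.

Definition dotv {n : nat} (x y : 'cV[R]_n) : R := \sum_i x i 0 * y i 0.

(* The library norm on matrices is the sup norm, hence this definition. *)
Definition enorm {n : nat} (x : 'cV[R]_n) : R := Num.sqrt (dotv x x).

Section Jordan.
Context {m : nat}.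
Implicit Types x y : 'cV[R]_m.+1.

Definition soc_head x : R := x 0 0.
Definition soc_tail x : 'cV[R]_m := dsubmx (x : 'cV[R]_(1 + m)).
Definition soc_pair (a : R) (v : 'cV[R]_m) : 'cV[R]_m.+1 :=
  (col_mx a%:M v : 'cV[R]_(1 + m)).

Definition in_soc x : Prop := enorm (soc_tail x) <= soc_head x.

Definition jordan_mul x y : 'cV[R]_m.+1 :=
  soc_pair (dotv x y)
           (soc_head y *: soc_tail x + soc_head x *: soc_tail y).

(* When x_2 = 0 the spectral direction is conventionally an arbitrary unit
   vector (and there is none when m = 0). The two spectral values are then
   equal, so the direction cancels in every expression
   f(lambda_1) u_1 + f(lambda_2) u_2; here it is 0, because 0^-1 = 0. *)
Definition soc_dir x : 'cV[R]_m := (enorm (soc_tail x))^-1 *: soc_tail x.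

Definition spec_val1 x : R := soc_head x - enorm (soc_tail x).
Definition spec_val2 x : R := soc_head x + enorm (soc_tail x).
Definition spec_vec1 x : 'cV[R]_m.+1 := 2^-1 *: soc_pair 1 (- soc_dir x).
Definition spec_vec2 x : 'cV[R]_m.+1 := 2^-1 *: soc_pair 1 (soc_dir x).

(* Meaningful for x in the cone, where both spectral values are >= 0. *)
Definition soc_sqrt x : 'cV[R]_m.+1 :=
  Num.sqrt (spec_val1 x) *: spec_vec1 x + Num.sqrt (spec_val2 x) *: spec_vec2 x.

Definition soc_abs x : 'cV[R]_m.+1 := soc_sqrt (jordan_mul x x).

End Jordan.

Lemma dotv_ge0 n (x : 'cV[R]_n) : 0 <= dotv x x.
Proof. by apply: sumr_ge0 => i _; rewrite -expr2 sqr_ge0. Qed.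

Lemma sqr_enorm n (x : 'cV[R]_n) : enorm x ^+ 2 = dotv x x.
Proof. by rewrite sqr_sqrtr // dotv_ge0. Qed.

Lemma enorm_ge0 n (x : 'cV[R]_n) : 0 <= enorm x.
Proof. exact: sqrtr_ge0. Qed.

Lemma enorm_eq0 n (x : 'cV[R]_n) : (enorm x == 0) = (x == 0).
Proof.
apply/idP/eqP => [/eqP h|->]; last first.
  by rewrite /enorm /dotv big1 ?sqrtr0 // => i _; rewrite mxE mul0r.
have /eqP := sqr_enorm x; rewrite h expr0n /= eq_sym psumr_eq0; last first.
  by move=> i _; rewrite -expr2 sqr_ge0.
move=> /allP h0; apply/matrixP => i j; rewrite ord1 mxE.
by have := h0 i (mem_index_enum i); rewrite mulf_eq0 orbb => /eqP.
Qed.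

Lemma enormZ n (a : R) (x : 'cV[R]_n) : enorm (a *: x) = `|a| * enorm x.
Proof.
rewrite /enorm (_ : dotv _ _ = a ^+ 2 * dotv x x).
  by rewrite sqrtrM ?sqr_ge0 // sqrtr_sqr.
by rewrite /dotv mulr_sumr; apply: eq_bigr => i _; rewrite !mxE; ring.
Qed.

Section JordanTheory.
Context {m : nat}.
Implicit Types x y : 'cV[R]_m.+1.

Lemma soc_headK (a : R) (v : 'cV[R]_m) : soc_head (soc_pair a v) = a.
Proof.
rewrite /soc_head /soc_pair.
have -> : (0 : 'I_m.+1) = lshift m (0 : 'I_1) by apply: val_inj.
by rewrite (@col_mxEu _ 1 m 1) mxE eqxx.
Qed.

Lemma soc_tailK (a : R) (v : 'cV[R]_m) : soc_tail (soc_pair a v) = v.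
Proof. exact: col_mxKd. Qed.

Lemma soc_pairK x : soc_pair (soc_head x) (soc_tail x) = x.
Proof.
rewrite /soc_pair /soc_tail -[RHS](@vsubmxK _ 1 m 1).
congr (@col_mx R 1 m 1 _ _).
apply/matrixP => i j; rewrite !ord1 !mxE eqxx /soc_head.
by congr (x _ _); apply: val_inj.
Qed.

Lemma soc_pairD (a c : R) (v w : 'cV[R]_m) :
  soc_pair a v + soc_pair c w = soc_pair (a + c) (v + w).
Proof. by rewrite /soc_pair raddfD -(@add_col_mx _ 1 m 1). Qed.

Lemma soc_pairZ (k a : R) (v : 'cV[R]_m) :
  k *: soc_pair a v = soc_pair (k * a) (k *: v).
Proof. by rewrite /soc_pair -scale_scalar_mx -(@scale_col_mx _ 1 m 1). Qed.

Lemma dotv_pair (a c : R) (v w : 'cV[R]_m) :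
  dotv (soc_pair a v) (soc_pair c w) = a * c + dotv v w.
Proof.
rewrite /dotv (@big_split_ord _ _ _ 1 m) /= big_ord1.
congr (_ + _).
  by rewrite /soc_pair !(@col_mxEu _ 1 m 1) !mxE eqxx.
by apply: eq_bigr => i _; rewrite /soc_pair !(@col_mxEd _ 1 m 1).
Qed.

Lemma enorm_dir x : enorm (soc_tail x) *: soc_dir x = soc_tail x.
Proof.
rewrite /soc_dir scalerA; have [/eqP|h] := eqVneq (enorm (soc_tail x)) 0.
  by rewrite enorm_eq0 => /eqP ->; rewrite scaler0.
by rewrite mulfV // scale1r.
Qed.

Lemma spec_sumE (a c : R) x :
  a *: spec_vec1 x + c *: spec_vec2 x =
  2^-1 *: soc_pair (a + c) ((c - a) *: soc_dir x).
Proof.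
rewrite /spec_vec1 /spec_vec2 !soc_pairZ soc_pairD.
congr soc_pair; first by ring.
by apply/matrixP => i j; rewrite !mxE; ring.
Qed.

Lemma spectral_decomposition x :
  x = spec_val1 x *: spec_vec1 x + spec_val2 x *: spec_vec2 x.
Proof.
rewrite spec_sumE /spec_val1 /spec_val2 soc_pairZ.
rewrite -[LHS]soc_pairK; congr soc_pair; first by field.
rewrite scalerA -[LHS]enorm_dir; congr (_ *: _); by field.
Qed.

Lemma soc_sqrtK x : in_soc x -> jordan_mul (soc_sqrt x) (soc_sqrt x) = x.
Proof.
rewrite /in_soc => cx; have e0 := enorm_ge0 (soc_tail x).
have l1 : 0 <= spec_val1 x by rewrite subr_ge0.
have l2 : 0 <= spec_val2 x by rewrite addr_ge0 // (le_trans e0).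
have := sqr_sqrtr l1; have := sqr_sqrtr l2.
rewrite /soc_sqrt spec_sumE soc_pairZ scalerA.
set s := Num.sqrt (spec_val1 x); set t := Num.sqrt (spec_val2 x).
set q := 2^-1 * (t - s) => tE sE.
have qE : dotv (q *: soc_dir x) (q *: soc_dir x) = q ^+ 2.
  rewrite -sqr_enorm !enormZ [_ ^+ 2]exprMn real_normK ?num_real //.
  rewrite [`|_^-1|]ger0_norm ?invr_ge0 //.
  have [h|h] := eqVneq (enorm (soc_tail x)) 0; last first.
    by rewrite mulVf // expr1n mulr1.
  suff -> : q = 0 by rewrite expr0n mul0r.
  by rewrite /q /t /s /spec_val1 /spec_val2 h addr0 subr0 subrr mulr0.
rewrite /jordan_mul dotv_pair qE soc_headK soc_tailK -scalerDl scalerA.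
rewrite -[RHS]soc_pairK; congr soc_pair.
  have -> : 2^-1 * (s + t) * (2^-1 * (s + t)) + q ^+ 2 =
            2^-1 * (s ^+ 2 + t ^+ 2) by rewrite /q; field.
  by rewrite sE tE /spec_val1 /spec_val2; field.
rewrite -[RHS]enorm_dir; congr (_ *: _).
have -> : (2^-1 * (s + t) + 2^-1 * (s + t)) * q = 2^-1 * (t ^+ 2 - s ^+ 2).
  by rewrite /q; field.
by rewrite sE tE /spec_val1 /spec_val2; field.
Qed.

Lemma soc_sqrt_in_soc x : in_soc (soc_sqrt x).
Proof.
rewrite /in_soc /soc_sqrt spec_sumE soc_pairZ soc_headK soc_tailK.
rewrite !enormZ [`|2^-1|]ger0_norm ?invr_ge0 ?ler0n //.
rewrite ler_wpM2l ?invr_ge0 ?ler0n //.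
have e0 := enorm_ge0 (soc_tail x).
have s0 := sqrtr_ge0 (spec_val1 x); have t0 := sqrtr_ge0 (spec_val2 x).
have st : `|Num.sqrt (spec_val2 x) - Num.sqrt (spec_val1 x)| <=
          Num.sqrt (spec_val1 x) + Num.sqrt (spec_val2 x).
  by rewrite ler_norml; apply/andP; split; lra.
apply: le_trans st; rewrite -[leRHS]mulr1 ler_wpM2l //.
rewrite ger0_norm ?invr_ge0 //.
by have [->|h] := eqVneq (enorm (soc_tail x)) 0; rewrite ?mulr0 // mulVf.
Qed.

Lemma jordan_sqrE x : jordan_mul x x =
  soc_pair (soc_head x ^+ 2 + enorm (soc_tail x) ^+ 2)
           ((2 * soc_head x) *: soc_tail x).
Proof.
rewrite /jordan_mul -{1 2}[x]soc_pairK dotv_pair sqr_enorm expr2.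
by rewrite -scalerDl -mulr2n mulr_natl.
Qed.

Lemma jordan_sqr_in_soc x : in_soc (jordan_mul x x).
Proof.
rewrite /in_soc jordan_sqrE soc_headK soc_tailK enormZ normrM.
rewrite [`|2|]ger0_norm ?ler0n // -[soc_head x ^+ 2]real_normK ?num_real //.
rewrite -subr_ge0; set a := `|_|; set e := enorm _.
have -> : a ^+ 2 + e ^+ 2 - 2 * a * e = (a - e) ^+ 2 by ring.
exact: sqr_ge0.
Qed.

(* For x_2 = 0 the formula reduces to (|x_1|, 0), see soc_abs_tail0. *)
Lemma soc_absE x :
  soc_abs x =
  2^-1 *: soc_pair
    (`|soc_head x - enorm (soc_tail x)| + `|soc_head x + enorm (soc_tail x)|)
    ((`|soc_head x + enorm (soc_tail x)| - `|soc_head x - enorm (soc_tail x)|)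
       *: ((enorm (soc_tail x))^-1 *: soc_tail x)).
Proof.
rewrite /soc_abs /soc_sqrt spec_sumE /spec_val1 /spec_val2 /soc_dir.
rewrite jordan_sqrE soc_headK soc_tailK enormZ normrM.
rewrite [`|2|]ger0_norm ?ler0n //.
set a := soc_head x; set v := soc_tail x.
have e0 := enorm_ge0 v; set e := enorm v in e0 *.
have -> : a ^+ 2 + e ^+ 2 - 2 * `|a| * e = (`|a| - e) ^+ 2.
  by rewrite -[a ^+ 2]real_normK ?num_real //; ring.
have -> : a ^+ 2 + e ^+ 2 + 2 * `|a| * e = (`|a| + e) ^+ 2.
  by rewrite -[a ^+ 2]real_normK ?num_real //; ring.
rewrite !sqrtr_sqr.
have [ap|an|->] := ltrgt0P a; last first.
- by rewrite !add0r normrN subrr !scale0r.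
- have -> : `|- a - e| = `|a + e| by rewrite -normrN; congr `|_|; ring.
  have -> : `|- a + e| = `|a - e| by rewrite -normrN; congr `|_|; ring.
  rewrite addrC; congr (_ *: soc_pair _ _).
  rewrite !scalerA; have [->|en0] := eqVneq e 0.
    by rewrite mulr0 invr0 !mulr0 !mul0r.
  by congr (_ *: _); field; rewrite en0 (lt_eqF an).
congr (_ *: soc_pair _ _); rewrite !scalerA.
have [->|en0] := eqVneq e 0; first by rewrite mulr0 invr0 !mulr0 !mul0r.
by congr (_ *: _); field; rewrite en0 (gt_eqF ap).
Qed.

Lemma soc_abs_tail0 x : soc_tail x = 0 -> soc_abs x = soc_pair `|soc_head x| 0.
Proof.
move=> t0; have /eqP e0 : enorm (soc_tail x) == 0 by rewrite enorm_eq0 t0.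
rewrite soc_absE e0 t0 !scaler0 subr0 addr0 soc_pairZ scaler0.
by congr soc_pair; field.
Qed.

End JordanTheory.
End SecondOrderCone.

(* The autonomous system dx/dt = g(x) is represented by its vector field g. *)
Definition equilibrium_point {R : realType} {n : nat}
    (g : 'cV[R]_n -> 'cV[R]_n) (x : 'cV[R]_n) : Prop :=
  g x = 0.

(* Main.v *)
Require Import Defs.
From mathcomp Require Import all_boot all_order all_algebra.
From mathcomp Require Import reals.

Set Implicit Arguments.
Unset Strict Implicit.
Unset Printing Implicit Defensive.

Import Order.TTheory GRing.Theory Num.Theory.
Local Open Scope ring_scope.

(** The vector field at [x] is the image of the residual [A *m x - soc_abs x - b] under the linear
    map [- gamma *: A^T]. This map is injective, because [gamma] is nonzero and [A^T] is invertible
    along with [A], so the field vanishes exactly where the residual does. *)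

Theorem theorem3p2 (R : realType) (m : nat) (A : 'M[R]_m.+1)
    (b : 'cV[R]_m.+1) (gamma : R) (hA : A \in unitmx) (hgamma : 0 < gamma)
    (xstar : 'cV[R]_m.+1) :
  A *m xstar - soc_abs xstar - b = 0 <->
  equilibrium_point
    (fun x : 'cV[R]_m.+1 => gamma *: (A^T *m (b + soc_abs x - A *m x))) xstar.
Proof.
have opp_residual : b + soc_abs xstar - A *m xstar =
    - (A *m xstar - soc_abs xstar - b).
  by rewrite !opprB [RHS]addrA.
rewrite /equilibrium_point opp_residual; split=> [->|/eqP].
  by rewrite oppr0 mulmx0 scaler0.
rewrite scaler_eq0 gt_eqF //= => /eqP ATr0.
apply/eqP; rewrite -oppr_eq0; apply/eqP.
have AT_unit : A^T \in unitmx by rewrite unitmx_tr.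
(* The negated residual is expanded as [invmx A^T *m (A^T *m _)], whose inner factor is zero by
   [ATr0]. *)
by rewrite -[LHS](mulKmx AT_unit) ATr0 mulmx0.
Qed.
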